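(* Let $p\ge 7$ be a prime, and let $A'_{p-1}=\sum_{k=0}^{p-1}\binom{p-1}{k}^2\binom{p-1+k}{k}$. Then $$A'_{p-1}\equiv 1+p^3\left(\frac{10}{3}B_{p-3}-\frac{5}{4}B_{2p-4}\right)+\frac{5}{18}p^4B_{p-3}\pmod{p^5}.$$
   Context: The Bernoulli numbers $B_n$ are defined by $\frac{x}{e^x-1}=\sum_{n=0}^{\infty}B_n\frac{x^n}{n!}$. For rational numbers $a,b$ whose denominators are prime to $p$, $a\equiv b\pmod{p^m}$ means that $a-b$ equals $p^m$ times a rational number with denominator prime to $p$. *)

(* Defs.v *)
From mathcomp Require Import all_boot all_order all_algebra.
Set Implicit Arguments. Unset Strict Implicit. Unset Printing Implicit Defensive.
Import Order.TTheory GRing.Theory Num.Theory.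
Local Open Scope ring_scope.

(* Bernoulli numbers B_0, ..., B_n (as rationals), computed by the recurrence
   sum_{k=0}^{n} C(n+1,k) B_k = 0 (n >= 1), B_0 = 1, which is the coefficient
   form of x = (e^x - 1) * sum_n B_n x^n / n!, i.e. x/(e^x-1) = sum B_n x^n/n!
   (so B_1 = -1/2). *)
Fixpoint bern_list (n : nat) : seq rat :=
  match n with
  | 0%N => [:: 1]
  | n'.+1 =>
      let s := bern_list n' in
      rcons s (- (n'.+2%:R)^-1 * \sum_(k < n'.+1) ('C(n'.+2, k))%:R * nth 0 s k)
  end.

Definition bernoulli (n : nat) : rat := nth 0 (bern_list n) n.

Definition p_integral (p : nat) (r : rat) : Prop := ~~ (p%:Z %| denq r)%Z.

Definition congr_mod_ppow (p m : nat) (a b : rat) : Prop :=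
  exists r : rat, p_integral p r /\ a - b = (p ^ m)%N%:R * r.

Definition Aprime (n : nat) : nat :=
  \sum_(k < n.+1) ('C(n, k) ^ 2 * 'C(n + k, k))%N.

(* Main.v *)
(* Write H_s for the sum of k^-s over 0 < k < p and S_m for the sum of k^m.
   With c_k = (-1)^(k+1) C(p,k), the k-th term of A'_{p-1} is c_k (1 - p/k)^2 prod_{j<k} (1 - p^2/j^2),
   and c_k is divisible by p. Truncating the product at p^2 and summing by parts reduces A' mod p^5
   to the sums of c_k / k^s (s = 0, 1, 2), which have closed forms in H_1 and H_2; this gives
   A' == 1 - p H_1 + 2 p^2 H_2. The reflection k -> p - k then turns it into A' == 1 + (5/2) p^2 H_2.
   To evaluate H_2 mod p^3, write k^(p-1) = 1 + x_k with p | x_k: the sum of k^(-2 + n(p-1)) is, mod p^3,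
   a quadratic polynomial in n, equal to H_2, S_{p-3}, S_{2p-4} at n = 0, 1, 2 and vanishing when
   n(p-1) = 2 mod p^2. Faulhaber's formula finally gives S_m == p B_m mod p^3 for m = p-3 and m = 2p-4. *)
Require Import Defs.
From mathcomp Require Import all_boot all_order all_algebra.
From mathcomp Require Import ring zify.
Set Implicit Arguments. Unset Strict Implicit. Unset Printing Implicit Defensive.
Import Order.TTheory GRing.Theory Num.Theory.
Local Open Scope ring_scope.

(** * Divisibility by powers of p among rationals *)

(** Divisibility by p^m in the ring of p-integral rationals; m = 0 is p-integrality itself. The
    fraction a/d need not be reduced, so sums and products only multiply denominators. *)
Definition pdvd (p m : nat) (r : rat) : Prop :=
  exists (a : int) (d : nat), ~~ (p %| d)%N /\ r = p%:R ^+ m * (a%:~R / d%:R).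

Section PDvd.

Variables (p : nat) (hp : prime p).

Lemma natr_neq0_ndvd (d : nat) : ~~ (p %| d)%N -> d%:R != 0 :> rat.
Proof. by rewrite pnatr_eq0; apply: contraNneq => ->; rewrite dvdn0. Qed.

Lemma natr_prime_neq0 : p%:R != 0 :> rat.
Proof. by rewrite pnatr_eq0 -lt0n prime_gt0. Qed.

Lemma pdvd_int (a : int) : pdvd p 0 a%:~R.
Proof. by exists a, 1%N; rewrite Euclid_dvd1 // expr0 mul1r divr1. Qed.

Lemma pdvd0 m : pdvd p m 0.
Proof. by exists 0, 1%N; rewrite Euclid_dvd1 // mul0r mulr0. Qed.

Lemma pdvdN m x : pdvd p m x -> pdvd p m (- x).
Proof. by move=> [a [d [dP ->]]]; exists (- a), d; rewrite rmorphN mulNr mulrN. Qed.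

Lemma pdvdD m x y : pdvd p m x -> pdvd p m y -> pdvd p m (x + y).
Proof.
move=> [a [d [dP ->]]] [b [e [eP ->]]]; exists (a * e%:Z + b * d%:Z), (d * e)%N.
split; first by rewrite Euclid_dvdM // negb_or dP.
by rewrite intrD !intrM natrM -!pmulrn; field; rewrite !natr_neq0_ndvd.
Qed.

Lemma pdvdB m x y : pdvd p m x -> pdvd p m y -> pdvd p m (x - y).
Proof. by move=> hx hy; apply: pdvdD => //; apply: pdvdN. Qed.

Lemma pdvdM m n x y : pdvd p m x -> pdvd p n y -> pdvd p (m + n) (x * y).
Proof.
move=> [a [d [dP ->]]] [b [e [eP ->]]]; exists (a * b), (d * e)%N.
split; first by rewrite Euclid_dvdM // negb_or dP.
by rewrite exprD intrM natrM; field; rewrite !natr_neq0_ndvd.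
Qed.

Lemma pdvdMl m x y : pdvd p 0 x -> pdvd p m y -> pdvd p m (x * y).
Proof. exact: pdvdM. Qed.

Lemma pdvdMr m x y : pdvd p m x -> pdvd p 0 y -> pdvd p m (x * y).
Proof. by rewrite mulrC => hx hy; apply: pdvdMl. Qed.

Lemma pdvd_nat (n : nat) : pdvd p 0 n%:R.
Proof. by rewrite pmulrn; apply: pdvd_int. Qed.

Lemma pdvd_pX m : pdvd p m (p%:R ^+ m).
Proof. by exists 1, 1%N; rewrite Euclid_dvd1 // rmorph1 divr1 /= ?mulr1. Qed.

Lemma pdvd_pXM m n x : pdvd p n x -> pdvd p (m + n) (p%:R ^+ m * x).
Proof. by apply: pdvdM; apply: pdvd_pX. Qed.

Lemma pdvdW n m x : (m <= n)%N -> pdvd p n x -> pdvd p m x.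
Proof.
move=> le_mn [a [d [dP ->]]].
rewrite -(subnKC le_mn) exprD -mulrA; apply: pdvdMr; first exact: pdvd_pX.
rewrite -natrX; apply: pdvdMl; first exact: pdvd_nat.
by exists a, d; rewrite mul1r.
Qed.

Lemma pdvd_natX m n : (p ^ m %| n)%N -> pdvd p m n%:R.
Proof.
move=> /dvdnP[k ->]; rewrite natrM natrX mulrC.
by apply: pdvdMr; [apply: pdvd_pX | apply: pdvd_nat].
Qed.

Lemma pdvdV d : ~~ (p %| d)%N -> pdvd p 0 d%:R^-1.
Proof. by move=> dP; exists 1, d; rewrite rmorph1 !mul1r. Qed.

Lemma pdvdX n m x : pdvd p m x -> pdvd p (n * m) (x ^+ n).
Proof.
move=> hx; elim: n => [|n IH]; first exact: (pdvd_nat 1).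
by rewrite exprS mulSn; apply: pdvdM.
Qed.

Lemma pdvdX0 n x : pdvd p 0 x -> pdvd p 0 (x ^+ n).
Proof. by move=> /(pdvdX n); rewrite muln0. Qed.

Lemma pdvd_sum (I : eqType) (s : seq I) (P : pred I) (F : I -> rat) m :
  (forall i, i \in s -> P i -> pdvd p m (F i)) -> pdvd p m (\sum_(i <- s | P i) F i).
Proof.
move=> h; rewrite big_seq_cond; apply: big_ind => [|x y|i /andP[]].
- exact: pdvd0.
- exact: pdvdD.
- exact: h.
Qed.

Lemma pdvd_unit d m x : ~~ (p %| d)%N -> pdvd p m (d%:R * x) -> pdvd p m x.
Proof.
move=> dP h; rewrite -[x](mulKf (natr_neq0_ndvd dP)).
by apply: pdvdMl => //; apply: pdvdV.
Qed.

(** Cross-multiply a/d with the reduced fraction: p dividing [denq x] is coprime to [numq x], so it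
    would divide d. *)
Lemma pdvd0_p_integral x : pdvd p 0 x -> p_integral p x.
Proof.
move=> [a [d [dP]]]; rewrite expr0 mul1r => xE.
have dn0 := natr_neq0_ndvd dP; apply: contra dP => hpd.
have e : numq x * d%:Z = a * denq x.
  apply: (@intr_inj rat); rewrite !intrM numqE -pmulrn xE; field; exact: dn0.
have : (p%:Z %| numq x * d%:Z)%Z by rewrite e dvdz_mull.
rewrite Gauss_dvdzr // /coprimez.
have := coprime_num_den x; rewrite coprime_sym => /(coprime_dvdl hpd) cop.
by rewrite /gcdz; move: cop; rewrite /coprime => /eqP->.
Qed.

End PDvd.

(** * Power sums modulo prime powers *)

Section PowerSumModular.
Local Open Scope nat_scope.
Variables (p : nat) (hp : prime p).

(** a^p - b^p is (a - b) times the sum of a^(p-1-i) b^i; p^s divides the first factor, and modulo p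
    the second consists of p equal terms. *)
Lemma eqn_mod_pexp s a b :
  0 < s -> a = b %[mod p ^ s] -> a ^ p = b ^ p %[mod p ^ s.+1].
Proof.
move=> s_gt0; wlog le_ba : a b / b <= a => [W|] ab.
  by have [/W->|/ltnW/W->] := leqP b a.
have p0 := prime_gt0 hp.
apply/eqP; rewrite eqn_mod_dvd ?leq_exp2r // subn_exp expnSr.
apply: dvdn_mul; first by rewrite -eqn_mod_dvd //; apply/eqP.
have abp : a = b %[mod p].
  by rewrite -(modn_dvdm a (dvdn_exp s_gt0 (dvdnn p))) ab modn_dvdm // dvdn_exp.
rewrite /dvdn -modn_summ (eq_bigr (fun i => b ^ p.-1 %% p)) => [|i _].
  by rewrite sum_nat_const card_ord modnMr.
rewrite -modnMml -modnXm abp modnXm modnMml -expnD; congr (_ ^ _ %% _).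
by have := ltn_ord i; lia.
Qed.

Lemma eqn_mod_pexp_iter r a b :
  a = b %[mod p] -> a ^ (p ^ r) = b ^ (p ^ r) %[mod p ^ r.+1].
Proof.
move=> ab; elim: r => [|r IH]; first by rewrite expn0 !expn1.
by rewrite expnSr !expnM; apply: eqn_mod_pexp.
Qed.

(* Multiplication by 2 permutes the residues modulo p, so it scales the sum by 2^E. *)
Lemma dvdn_powsum r e : 2 < p -> 0 < e -> 2 ^ e != 1 %[mod p] ->
  p ^ r.+1 %| \sum_(1 <= k < p) k ^ (p ^ r * e).
Proof.
move=> p2 e0 he; have p0 := prime_gt0 hp.
set E := p ^ r * e.
have E0 : 0 < E by rewrite muln_gt0 expn_gt0 p0.
have -> : \sum_(1 <= k < p) k ^ E = \sum_(k < p) k ^ E.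
  by rewrite -(big_mkord xpredT (fun k => k ^ E)) [RHS]big_ltn // exp0n.
pose f (k : 'I_p) := Ordinal (ltn_pmod (2 * k) p0).
have f_inj : injective f.
  move=> k l /(congr1 val) /= kl; apply: val_inj => /=.
  wlog le_lk : k l kl / l <= k => [W|].
    by have [/W->|/ltnW/W->] := leqP l k.
  move/eqP: kl; rewrite eqn_mod_dvd ?leq_mul2l // -mulnBr Gauss_dvdr; last first.
    by rewrite prime_coprime // gtnNdvd.
  have := ltn_ord k; have [|kl0 kp] := posnP (k - l); first by lia.
  by move/(dvdn_leq kl0); lia.
(* Reducing 2k modulo p preserves it only modulo p; the factor p^r of the exponent lifts this to
   agreement modulo p^(r+1). *)
have key : 2 ^ E * (\sum_(k < p) k ^ E) = \sum_(k < p) k ^ E %[mod p ^ r.+1].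
  rewrite [in RHS](reindex_inj f_inj) big_distrr /= -modn_summ -[in RHS]modn_summ.
  congr (_ %% _); apply: eq_bigr => k _.
  rewrite -expnMn /E !expnM -modnXm -[in RHS]modnXm.
  by congr (_ ^ _ %% _); apply: eqn_mod_pexp_iter; rewrite modn_mod.
have E1 : 0 < 2 ^ E by rewrite expn_gt0.
move/eqP: key; rewrite eqn_mod_dvd ?leq_pmull // -{2}[\sum_(k < p) _]mul1n -mulnBl.
rewrite Gauss_dvdr // coprimeXl // prime_coprime //.
(* Fermat gives 2^(p^r e) = 2^e modulo p, so 2^E - 1 is prime to p and can be cancelled. *)
rewrite -eqn_mod_dvd //; suff -> : 2 ^ E = 2 ^ e %[mod p] by [].
rewrite /E mulnC expnM; elim: r {E E0 f f_inj E1} => [|r IH]; first by rewrite expn1.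
by rewrite expnSr expnM fermat_little.
Qed.
End PowerSumModular.

(** * Faulhaber's formula *)

Lemma size_bern_list n : size (bern_list n) = n.+1.
Proof. by elim: n => //= n IH; rewrite size_rcons IH. Qed.

Lemma nth_bern_list n k : (k <= n)%N -> nth 0 (bern_list n) k = bernoulli k.
Proof.
elim: n => [|n IH] le_kn; first by move: le_kn; rewrite leqn0 => /eqP->.
have [le|lt] := leqP k n; last by have -> : k = n.+1 by apply/eqP; rewrite eqn_leq le_kn.
by rewrite /= nth_rcons size_bern_list ltnS le IH.
Qed.

Lemma bernoulli0 : bernoulli 0 = 1.
Proof. by []. Qed.

Lemma bernoulliS n :
  bernoulli n.+1 = - (n.+2%:R)^-1 * \sum_(k < n.+1) ('C(n.+2, k))%:R * bernoulli k.
Proof.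
rewrite /bernoulli /= nth_rcons size_bern_list ltnn eqxx; congr (_ * _).
by apply: eq_bigr => k _; rewrite nth_bern_list // -ltnS.
Qed.

Lemma sum_bin_bernoulli n :
  \sum_(k < n.+1) ('C(n.+1, k))%:R * bernoulli k = (n == 0%N)%:R.
Proof.
case: n => [|n]; first by rewrite big_ord1 bin0 bernoulli0 mulr1.
rewrite big_ord_recr /= bernoulliS binSn; field.
by rewrite -[1]/(1%:R) -natrD pnatr_eq0.
Qed.

(** Both sides are the trinomial coefficient m! / (i! j! (m-i-j)!). *)
Lemma bin_mul_bin m i j : (i + j <= m)%N ->
  ('C(m, j) * 'C(m - j, i) = 'C(m, i) * 'C(m - i, j))%N.
Proof.
move=> le_m.
have f0 k : (0 < k`!)%N := fact_gt0 k.
apply/eqP; rewrite -(eqn_pmul2r (f0 i)) -(eqn_pmul2r (f0 j)) -(eqn_pmul2r (f0 (m - i - j)%N)).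
have e1 := @bin_fact m j; have e2 := @bin_fact (m - j) i.
have e3 := @bin_fact m i; have e4 := @bin_fact (m - i) j.
have e5 : (m - j - i = m - i - j)%N by lia.
rewrite e5 in e2.
apply/eqP; transitivity (m`!)%N.
  rewrite -e1 -?e2; [ring | lia..].
by rewrite -e3 -?e4; [ring | lia..].
Qed.

(** Induction on N: in the increment of the right side, expanded in powers of N, the coefficient of
    N^i is C(m+1,i) times a Bernoulli recurrence sum, which vanishes unless i = m. *)
Lemma faulhaber m N :
  (m.+1)%:R * \sum_(0 <= k < N) k%:R ^+ m
  = \sum_(j < m.+1) ('C(m.+1, j))%:R * bernoulli j * N%:R ^+ (m.+1 - j) :> rat.
Proof.
elim: N => [|N IH].
  rewrite big_geq // mulr0 big1 // => j _.
  by rewrite expr0n subn_eq0 leqNgt ltn_ord mulr0.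
rewrite big_nat_recr //= mulrDr IH.
apply/eqP; rewrite -subr_eq0 -opprB oppr_eq0 opprD addrA -sumrB subr_eq0; apply/eqP.
(* Extending by 0 outside the triangle i + j <= m makes both index ranges the full square, so the
   sums can be exchanged. *)
pose G (i j : 'I_m.+1) : rat :=
  if (i + j < m.+1)%N then N%:R ^+ i * ('C(m.+1, i))%:R * ('C(m.+1 - i, j))%:R * bernoulli j else 0.
transitivity (\sum_(j < m.+1) \sum_(i < m.+1) G i j).
  apply: eq_bigr => j _; rewrite -mulrBr -[N.+1]addn1 natrD exprD1n.
  have le_jm : (m.+1 - j <= m.+1)%N by rewrite leq_subr.
  rewrite big_ord_recr /= binn mulr1n addrK.
  rewrite (big_ord_widen _ (fun i => (N%:R ^+ i *+ 'C(m.+1 - j, i) : rat)) le_jm).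
  rewrite big_mkcond mulr_sumr; apply: eq_bigr => i _; rewrite /G.
  have -> : (i < m.+1 - j)%N = (i + j < m.+1)%N by lia.
  case: ifP => // lt; rewrite ?mulr0 // -mulr_natr.
  have /(congr1 (fun n => n%:R : rat)) := bin_mul_bin (ltnW lt).
  by rewrite !natrM => e; rewrite -(mulrA (N%:R ^+ i)) -e; ring.
rewrite exchange_big /= (bigD1 ord_max) //= [X in _ + X]big1 ?addr0 => [|i ne_im].
  rewrite (bigD1 ord0) //= [X in _ + X]big1 ?addr0 => [|j ne_j0].
    by rewrite /G /= addn0 ltnSn subSnn bin0 bernoulli0 binSn; ring.
  rewrite /G ifN // -leqNgt /=; have : nat_of_ord j != 0%N by exact: ne_j0.
  by lia.
have lt_im : (i < m)%N.
  by rewrite ltn_neqAle -ltnS ltn_ord andbT; exact: ne_im.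
have le_m : (m.+1 - i <= m.+1)%N by rewrite leq_subr.
pose c := N%:R ^+ i * ('C(m.+1, i))%:R : rat.
transitivity (c * \sum_(j < m.+1 - i) ('C(m.+1 - i, j))%:R * bernoulli j).
  rewrite (big_ord_widen _ (fun j => ('C(m.+1 - i, j))%:R * bernoulli j) le_m).
  rewrite [in RHS]big_mkcond mulr_sumr; apply: eq_bigr => j _; rewrite /G.
  have -> : (j < m.+1 - i)%N = (i + j < m.+1)%N by lia.
  by case: ifP => _; rewrite ?mulr0 // mulrA.
by rewrite subSn ?(ltnW lt_im) // sum_bin_bernoulli subn_eq0 leqNgt lt_im mulr0.
Qed.

(** * Power sums and Bernoulli numbers modulo p, p^2 and p^3 *)

Definition powsum (p m : nat) : rat := \sum_(1 <= k < p) k%:R ^+ m.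

Section PowerSum.
Variables (p : nat) (hp : prime p).

(** Faulhaber's formula at N = p in reversed order. One factor p stays with the Bernoulli number,
    because p B_j is p-integral; the remaining weight p^i/(i+1) becomes p-adically small as i
    grows. *)
Lemma powsum_bernoulli m : (0 < m)%N ->
  powsum p m = \sum_(i < m.+1) ('C(m, i))%:R * (p%:R * bernoulli (m - i))
                               * (p%:R ^+ i / i.+1%:R).
Proof.
move=> m0; have := faulhaber m p.
rewrite big_ltn ?prime_gt0 // expr0n eqn0Ngt m0 add0r -/(powsum p m) => e.
have m1 : m.+1%:R != 0 :> rat by rewrite pnatr_eq0.
apply: (mulfI m1); rewrite e (reindex_inj rev_ord_inj) mulr_sumr.
apply: eq_bigr => i _ /=; have lt_im := ltn_ord i.
have -> : (m.+1 - i.+1 = m - i)%N by lia.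
have -> : (m.+1 - (m - i) = i.+1)%N by lia.
have -> : 'C(m.+1, m - i) = 'C(m.+1, i.+1).
  by rewrite -(@bin_sub m.+1 i.+1) // subSS.
have /(congr1 (fun n => n%:R : rat)) := mul_bin_diag m.+1 i.
rewrite !natrM => eb; rewrite exprS.
have i1 : i.+1%:R != 0 :> rat by rewrite pnatr_eq0.
apply: (mulfI i1); rewrite !mulrA -eb; field; rewrite -[1]/(1%:R) -natrD add1n; exact: i1.
Qed.

(** With v the p-adic valuation of i+1, one needs v + c <= i. This is [ci] if v = 0; otherwise i + 1
    >= 7^v >= v + 4 leaves room for c <= 3. *)
Lemma pdvd_pow_div_succ c i : (7 <= p)%N -> (c <= 3)%N -> (c <= i)%N ->
  pdvd p c (p%:R ^+ i / i.+1%:R).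
Proof.
move=> p7 c3 ci.
have [d cop iE] := pfactor_coprime hp (ltn0Sn i); set v := logn p i.+1 in iE.
have dP : ~~ (p %| d)%N by rewrite -prime_coprime.
have v_le : (v + c <= i)%N.
  have d0 : (0 < d)%N by case: (d) iE => //; rewrite mul0n.
  have : (p ^ v <= i.+1)%N by rewrite iE leq_pmull.
  case: (v) => [|u]; first by lia.
  have : (u.+1 + 4 <= 7 ^ u.+1)%N.
    by elim: u => // u IH; rewrite expnS; lia.
  have : (7 ^ u.+1 <= p ^ u.+1)%N by rewrite leq_exp2r.
  lia.
have -> : p%:R ^+ i / i.+1%:R = p%:R ^+ (i - v) * d%:R^-1 :> rat.
  rewrite iE natrM natrX -{1}(subnK (leq_trans (leq_addr c v) v_le)) exprD.
  by field; rewrite (natr_neq0_ndvd dP) expf_neq0 ?natr_prime_neq0.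
apply: (pdvdMr hp); last exact: pdvdV.
by apply: (pdvdW hp (n := i - v)); [lia | apply: pdvd_pX].
Qed.

Lemma pdvd_powsum_term m i c b : (7 <= p)%N -> (c <= 3)%N -> (c <= i)%N ->
  pdvd p b (p%:R * bernoulli (m - i)) ->
  pdvd p (b + c) (('C(m, i))%:R * (p%:R * bernoulli (m - i)) * (p%:R ^+ i / i.+1%:R)).
Proof.
move=> p7 c3 ci hB; apply: pdvdM => //; last exact: pdvd_pow_div_succ.
by apply: pdvdMl => //; apply: pdvd_nat.
Qed.

(** A weak form of von Staudt's theorem: the term i = 0 of [powsum_bernoulli] is p B_m, the power
    sum is an integer, and all other terms involve smaller indices. *)
Lemma pdvd_pM_bernoulli m : (7 <= p)%N -> pdvd p 0 (p%:R * bernoulli m).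
Proof.
move=> p7; elim/ltn_ind: m => m IH.
have [->|m0] := posnP m; first by rewrite bernoulli0 mulr1; apply: pdvd_nat.
have -> : p%:R * bernoulli m = powsum p m - (powsum p m - p%:R * bernoulli m) by ring.
apply: pdvdB => //.
  by apply: pdvd_sum => // k _ _; rewrite -natrX; apply: pdvd_nat.
rewrite powsum_bernoulli // big_ord_recl bin0 subn0 expr0 divr1 !mul1r.
rewrite addrAC subrr add0r; apply: pdvd_sum => // i _ _.
have lt_im := ltn_ord i.
by apply: (@pdvd_powsum_term _ _ 0 0) => //; apply: IH; rewrite /= /bump; lia.
Qed.

Lemma powsum_bernoulli_modp m : (7 <= p)%N -> (0 < m)%N ->
  pdvd p 1 (powsum p m - p%:R * bernoulli m).
Proof.
move=> p7 m0.
rewrite powsum_bernoulli // big_ord_recl bin0 subn0 expr0 divr1 !mul1r.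
rewrite addrAC subrr add0r; apply: pdvd_sum => // i _ _.
by apply: (@pdvd_powsum_term _ _ 1 0) => //; apply: pdvd_pM_bernoulli.
Qed.

Lemma powsum_bernoulli_modp2 m : (7 <= p)%N -> (1 < m)%N ->
  pdvd p 1 (powsum p m.-1) -> pdvd p 2 (powsum p m - p%:R * bernoulli m).
Proof.
move=> p7 m1 hS.
have hB : pdvd p 1 (p%:R * bernoulli m.-1).
  have -> : p%:R * bernoulli m.-1
      = powsum p m.-1 - (powsum p m.-1 - p%:R * bernoulli m.-1) by ring.
  by apply: pdvdB => //; apply: powsum_bernoulli_modp => //; lia.
rewrite powsum_bernoulli ?(ltnW m1) // big_ord_recl bin0 subn0 expr0 divr1 !mul1r.
rewrite addrAC subrr add0r; apply: pdvd_sum => // i _ _.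
rewrite /= /bump /=; case: (nat_of_ord i) => [|j].
  by apply: (@pdvd_powsum_term _ _ 1 1) => //; rewrite subn1.
by apply: (@pdvd_powsum_term _ _ 2 0) => //; apply: pdvd_pM_bernoulli.
Qed.

(** In [powsum_bernoulli] the weights for i = 1, i = 2 and i >= 3 are divisible by p, p^2 and p^3.
    The missing p^2 and p for i = 1, 2 come from the hypotheses, carried over to p B_(m-1) and p
    B_(m-2) by the weaker congruences. *)
Lemma powsum_bernoulli_modp3 m : (7 <= p)%N -> (2 < m)%N ->
  pdvd p 2 (powsum p m.-1) -> pdvd p 1 (powsum p m.-2) ->
  pdvd p 3 (powsum p m - p%:R * bernoulli m).
Proof.
move=> p7 m1 hS1 hS2.
have hB1 : pdvd p 2 (p%:R * bernoulli m.-1).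
  have -> : p%:R * bernoulli m.-1
      = powsum p m.-1 - (powsum p m.-1 - p%:R * bernoulli m.-1) by ring.
  by apply: pdvdB => //; apply: powsum_bernoulli_modp2 => //; lia.
have hB2 : pdvd p 1 (p%:R * bernoulli m.-2).
  have -> : p%:R * bernoulli m.-2
      = powsum p m.-2 - (powsum p m.-2 - p%:R * bernoulli m.-2) by ring.
  by apply: pdvdB => //; apply: powsum_bernoulli_modp => //; lia.
have m0 : (0 < m)%N by lia.
rewrite powsum_bernoulli // big_ord_recl bin0 subn0 expr0 divr1 !mul1r.
rewrite addrAC subrr add0r; apply: pdvd_sum => // i _ _.
rewrite /= /bump /=; case: (nat_of_ord i) => [|[|j]].
- by apply: (@pdvd_powsum_term _ _ 1 2) => //; rewrite subn1.
- by apply: (@pdvd_powsum_term _ _ 2 1) => //; rewrite subn2.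
- by apply: (@pdvd_powsum_term _ _ 3 0) => //; apply: pdvd_pM_bernoulli.
Qed.

Lemma pdvd_powsum r e : (2 < p)%N -> (0 < e)%N -> 2 ^ e != 1 %[mod p] ->
  pdvd p r.+1 (powsum p (p ^ r * e)).
Proof.
move=> p2 e0 he; have := dvdn_powsum hp r p2 e0 he.
move/(pdvd_natX hp); congr pdvd.
by rewrite /powsum natr_sum; apply: eq_bigr => k _; rewrite natrX.
Qed.

Lemma sum_nat_subn (F : nat -> rat) :
  \sum_(1 <= k < p) F (p - k)%N = \sum_(1 <= k < p) F k.
Proof. by rewrite [RHS]big_nat_rev /=; apply: eq_bigr => k _; rewrite add1n subSS. Qed.

Lemma exprD_modp2 x y n : pdvd p 1 x -> pdvd p 0 y ->
  pdvd p 2 ((x + y) ^+ n.+1 - y ^+ n.+1 - n.+1%:R * x * y ^+ n).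
Proof.
move=> hx hy; elim: n => [|n IH].
  have -> : (x + y) ^+ 1 - y ^+ 1 - 1%:R * x * y ^+ 0 = 0 by ring.
  exact: pdvd0.
set t := _ - _ in IH.
have -> : (x + y) ^+ n.+2 - y ^+ n.+2 - n.+2%:R * x * y ^+ n.+1
   = (x + y) * t + n.+1%:R * x ^+ 2 * y ^+ n.
  by rewrite /t !exprS -[n.+2]addn1 natrD; ring.
apply: pdvdD => //.
  by apply: pdvdMl => //; apply: pdvdD => //; apply: pdvdW hx.
apply: pdvdMr => //; last exact: pdvdX0.
by apply: pdvdMl => //; [apply: pdvd_nat | apply: (pdvdX hp 2 hx)].
Qed.

(** Pair k with p - k: as n+1 is odd, (p-k)^(n+1) + k^(n+1) is (n+1) p k^n modulo p^2, and summing
    k^n gives another p. *)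
Lemma pdvd2_powsum_odd n : (2 < p)%N -> ~~ odd n ->
  pdvd p 1 (powsum p n) -> pdvd p 2 (powsum p n.+1).
Proof.
move=> p2 en hS; apply: (@pdvd_unit _ hp 2); first by rewrite gtnNdvd.
have -> : 2%:R * powsum p n.+1 =
   \sum_(1 <= k < p) ((p%:R + - k%:R) ^+ n.+1 - (- k%:R) ^+ n.+1
        - n.+1%:R * p%:R * (- k%:R) ^+ n) + n.+1%:R * p%:R * powsum p n.
  have -> : 2%:R * powsum p n.+1 = powsum p n.+1 + powsum p n.+1 by ring.
  rewrite {1}/powsum -(sum_nat_subn (fun k => k%:R ^+ n.+1)) /powsum mulr_sumr -!big_split /=.
  apply: eq_big_nat => k /andP[_ kp]; rewrite natrB ?(ltnW kp) //.
  have e0 : (-1) ^+ n = 1 :> rat by rewrite -signr_odd (negbTE en).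
  by rewrite !(exprNn k%:R) [(-1) ^+ n.+1]exprS e0; ring.
apply: pdvdD => //.
  apply: pdvd_sum => // k _ _; apply: exprD_modp2; first exact: (pdvd_pX hp 1).
  by apply: pdvdN => //; apply: pdvd_nat.
rewrite -mulrA; apply: pdvdMl => //; first exact: pdvd_nat.
exact: (pdvd_pXM hp 1 hS).
Qed.

End PowerSum.

(** * Harmonic sums *)

Definition hsum (p s : nat) : rat := \sum_(1 <= k < p) k%:R ^- s.

Section Harmonic.
Variables (p : nat) (hp : prime p).

Lemma ndvd_lt k : (0 < k < p)%N -> ~~ (p %| k)%N.
Proof. by case/andP=> k0 kp; rewrite gtnNdvd. Qed.

Lemma pdvd_fermat k : (0 < k < p)%N -> pdvd p 1 (k%:R ^+ p.-1 - 1).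
Proof.
move=> kP; have k0 : (0 < k)%N by case/andP: kP.
apply: (pdvd_unit hp (ndvd_lt kP)).
rewrite mulrBr mulr1 -exprS (prednK (prime_gt0 hp)).
rewrite -natrX -natrB; last by rewrite -{1}[k]expn1 leq_pexp2l // prime_gt0.
apply: pdvd_natX => //; rewrite expn1 -eqn_mod_dvd ?fermat_little //.
by rewrite -{1}[k]expn1 leq_pexp2l // prime_gt0.
Qed.

Lemma pdvd_invX k s : (0 < k < p)%N -> pdvd p 0 (k%:R ^- s).
Proof.
by move=> kP; rewrite -natrX; apply: pdvdV; rewrite Euclid_dvdX // (negbTE (ndvd_lt kP)).
Qed.

Lemma expr1D_modp3 x n : pdvd p 1 x ->
  pdvd p 3 ((1 + x) ^+ n - (1 + n%:R * x + ('C(n, 2))%:R * x ^+ 2)).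
Proof.
move=> hx; elim: n => [|n IH].
  by rewrite !mul0r !addr0 subrr; apply: pdvd0.
set t := _ - _ in IH.
have -> : (1 + x) ^+ n.+1 - (1 + n.+1%:R * x + ('C(n.+1, 2))%:R * x ^+ 2)
   = (1 + x) * t + ('C(n, 2))%:R * x ^+ 3.
  by rewrite /t binS bin1 exprS natrD -[n.+1]addn1 natrD; ring.
apply: pdvdD => //.
  by apply: pdvdMl => //; apply: pdvdD => //; [apply: (pdvd_nat hp 1) | apply: pdvdW hx].
by apply: pdvdMl => //; [apply: pdvd_nat | apply: (pdvdX hp 3 hx)].
Qed.

(** By Fermat 2^(e+i) = 1 modulo p, so 2^e = 1 would force 2^i = 1; a large exponent e is thus
    tested through a small i. *)
Lemma pow2_neq1_modp e i : (2 < p)%N -> ~~ (p %| 2 ^ i - 1)%N -> (p.-1 %| e + i)%N ->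
  2 ^ e != 1 %[mod p].
Proof.
move=> p2 hi /dvdnP[q ei]; apply: contra hi => /eqP h.
rewrite -eqn_mod_dvd ?expn_gt0 //; apply/eqP.
have f : (2 ^ p.-1 = 1 %[mod p])%N.
  have cop : coprime p 2 by rewrite prime_coprime // gtnNdvd.
  apply/eqP; rewrite eqn_mod_dvd ?expn_gt0 // -(Gauss_dvdr _ cop).
  rewrite mulnBr muln1 -expnS (prednK (prime_gt0 hp)) -eqn_mod_dvd ?fermat_little //.
  by rewrite -{1}[2%N]expn1 leq_pexp2l ?prime_gt0.
have : (2 ^ (e + i) = 1 %[mod p])%N by rewrite ei mulnC expnM -modnXm f modnXm exp1n.
by rewrite expnD -modnMml h modnMml mul1n.
Qed.

Lemma natr_bin2 (n : nat) : 2 * ('C(n, 2))%:R = n%:R * (n%:R - 1) :> rat.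
Proof.
case: n => [|n]; first by rewrite mul0r mulr0.
have /(congr1 (fun k => k%:R : rat)) := mul_bin_diag n.+1 1.
by rewrite /= bin1 !natrM => <-; rewrite -[n.+1]addn1 natrD addrK.
Qed.

(* k^(p^2 (p-3)) = k^-2 (k^(p-1))^n for n = p^2 - 2p - 2, and the sum of these
   powers vanishes mod p^3. As k^(p-1) = 1 + x_k with p | x_k, this is a linear
   relation between the sums of k^-2, k^-2 x_k and k^-2 x_k^2. *)
Lemma hsum2_powsum : (7 <= p)%N ->
  pdvd p 3 (hsum p 2 - (4 / 3 * powsum p (p - 3) - 1 / 2 * powsum p (2 * p - 4)
                        + p%:R / 9 * powsum p (p - 3))).
Proof.
move=> p7.
have h2 : 2 ^ (p - 3) != 1 %[mod p].
  apply: (@pow2_neq1_modp _ 2); [lia | by rewrite gtnNdvd //; lia | by apply/dvdnP; exists 1%N; lia].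
pose x k : rat := k%:R ^+ p.-1 - 1.
have hx k : (0 < k < p)%N -> pdvd p 1 (x k) := @pdvd_fermat k.
set a := hsum p 2.
pose u := \sum_(1 <= k < p) k%:R ^- 2 * x k.
pose v := \sum_(1 <= k < p) k%:R ^- 2 * x k ^+ 2.
have k0 k : (0 < k < p)%N -> k%:R != 0 :> rat by move/ndvd_lt/natr_neq0_ndvd.
have hu : pdvd p 1 u.
  apply: pdvd_sum => // k; rewrite mem_index_iota => kP _.
  by apply: pdvdMl => //; [apply: pdvd_invX | apply: hx].
have hv : pdvd p 2 v.
  apply: pdvd_sum => // k; rewrite mem_index_iota => kP _.
  by apply: pdvdMl => //; [apply: pdvd_invX | apply: (pdvdX hp 2 (hx k kP))].
(* The exponents p-3 and 2p-4 are n(p-1) - 2 for n = 1 and n = 2. *)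
have e1 : powsum p (p - 3) = a + u.
  rewrite /powsum /a /hsum /u -big_split /=; apply: eq_big_nat => k kP.
  have -> : (p - 3 = p.-1 - 2)%N by lia.
  rewrite expfB ?k0 //; last by lia.
  by rewrite /x; field; apply: k0.
have e2 : powsum p (2 * p - 4) = a + 2%:R * u + v.
  rewrite /powsum /a /hsum /u /v mulr_sumr -!big_split /=; apply: eq_big_nat => k kP.
  have -> : (2 * p - 4 = p.-1 * 2 - 2)%N by lia.
  rewrite expfB ?k0 //; last by lia.
  by rewrite exprM /x; field; apply: k0.
have [n pn] : exists n, (n + 2 * p + 2 = p ^ 2)%N.
  by exists (p ^ 2 - 2 * p - 2)%N; nia.
have expE : (p.-1 * n = p ^ 2 * (p - 3) + 2)%N.
  have pE : p = (p - 3 + 3)%N by lia.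
  move: (p - 3)%N pE pn => r -> pn.
  have -> : (n = r ^ 2 + 4 * r + 1)%N by lia.
  by rewrite addn3 /=; ring.
set C : rat := ('C(n, 2))%:R.
have e3 : pdvd p 3 (a + n%:R * u + C * v).
  have -> : a + n%:R * u + C * v = powsum p (p ^ 2 * (p - 3))
     - \sum_(1 <= k < p) k%:R ^- 2 *
         ((1 + x k) ^+ n - (1 + n%:R * x k + C * x k ^+ 2)).
    rewrite /powsum /a /hsum /u /v !mulr_sumr -sumrB -!big_split /=.
    apply: eq_big_nat => k kP.
    rewrite -(addnK 2 (p ^ 2 * (p - 3))%N) -expE expfB ?k0 //; last by rewrite expE addn2 !ltnS muln_gt0 expn_gt0; lia.
    have -> : k%:R ^+ (p.-1 * n) = (1 + x k) ^+ n by rewrite exprM /x addrC subrK.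
    by move: (x k) (n%:R) => y N; ring.
  apply: pdvdB => //; first by apply: pdvd_powsum => //; lia.
  apply: pdvd_sum => // k; rewrite mem_index_iota => kP _.
  by apply: pdvdMl => //; [apply: pdvd_invX | apply/expr1D_modp3/hx].
have CE : 2 * C = n%:R * (n%:R - 1) := natr_bin2 n.
have hC : pdvd p 0 C by apply: pdvd_nat.
have nE : n%:R = p%:R ^+ 2 - 2 * p%:R - 2 :> rat.
  by have /(congr1 (fun m => m%:R : rat)) := pn; rewrite 2!natrD natrX natrM => <-; ring.
have pv (k : nat) w m : pdvd p m w -> pdvd p m (k%:R * w).
  by move=> hw; apply: pdvdMl => //; apply: pdvd_nat.
move: (n%:R) (C) nE CE e3 hC => N c nE CE e3 hC.
have p36 : ~~ (p %| 36)%N.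
  by rewrite (_ : 36 = 2 ^ 2 * 3 ^ 2)%N // Euclid_dvdM // !Euclid_dvdX // !gtnNdvd //; lia.
rewrite {}e1 {}e2; apply: (pdvd_unit hp p36).
move: (pdvd_pX hp 1); rewrite expr1; move: (p%:R) nE => P nE hP.
set R := a + N * u + c * v in e3.
(* The multiple (6 - 4p) R eliminates a. What remains of u carries p^2, and what remains of v
   carries p: n = -2 modulo p makes C(n,2) = 3, so 18 - 6 C(n,2) vanishes modulo p. *)
have -> : 36%:R * (a - (4 / 3 * (a + u) - 1 / 2 * (a + 2%:R * u + v) + P / 9 * (a + u)))
   = 6%:R * R - 4%:R * (P * R) + 2%:R * (2%:R * P - 7%:R) * (P ^+ 2 * u)
     + (4%:R * c - 3%:R * ((P - 2%:R) * (P ^+ 2 - 2%:R * P - 5%:R))) * (P * v).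
  have cE : c = 2^-1 * (P ^+ 2 - 2 * P - 2) * (P ^+ 2 - 2 * P - 3).
    by apply: (@mulfI _ 2) => //; rewrite CE nE; field.
  by rewrite /R cE nE; field.
have hP0 : pdvd p 0 P := pdvdW hp (leq0n 1) hP.
have hn k : pdvd p 0 k%:R := pdvd_nat hp k.
have hP2 := pdvdX hp 2 hP.
have hPB k : pdvd p 0 (P - k%:R) by apply: pdvdB.
apply: pdvdD => //; [apply: pdvdD => //; [apply: pdvdB => //|] |].
- exact: pdvdMl.
- by apply: pdvdMl => //; apply: pdvdMl.
- apply: pdvdMl => //; last exact: (pdvdM hp hP2 hu).
  by apply: pdvdMl => //; apply: pdvdB => //; apply: pdvdMl.
apply: pdvdMl => //; last exact: (pdvdM hp hP hv).
apply: pdvdB => //; first by apply: pdvdMl.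
apply: pdvdMl => //; apply: pdvdMl => //; apply: pdvdB => //.
by apply: pdvdB => //; [apply: pdvdX0 | apply: pdvdMl].
Qed.
End Harmonic.

(** * Alternating binomial sums *)

Lemma natr_neq0 (n : nat) : (0 < n)%N -> n%:R != 0 :> rat.
Proof. by rewrite pnatr_eq0 lt0n. Qed.

Lemma hsumS n s : (0 < n)%N -> hsum n.+1 s = hsum n s + n%:R ^- s.
Proof. by move=> n0; rewrite /hsum big_nat_recr. Qed.

Definition altbin (s n : nat) : rat :=
  \sum_(1 <= k < n.+1) (-1) ^+ k.+1 * ('C(n, k))%:R / k%:R ^+ s.

Lemma altbin0 n : (0 < n)%N -> altbin 0 n = 1.
Proof.
move=> n0; have /eqP := exprD1n (-1 : rat) n.
rewrite addNr expr0n eqn0Ngt n0 -(big_mkord xpredT (fun i => (-1) ^+ i *+ 'C(n, i))).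
rewrite big_ltn // bin0 expr0 eq_sym addrC addr_eq0 => /eqP e.
rewrite -[1 in RHS](opprK 1) -[X in - X]mulr1n -[X in - X]e -sumrN; apply: eq_bigr => k _.
by rewrite expr0 divr1 exprS mulN1r mulNr mulr_natr.
Qed.

(** Pascal's rule splits C(n+1,k); the part C(n,k-1)/k equals C(n+1,k)/(n+1), which lowers the power
    of k by one. Telescoping then gives the closed forms for s = 1, 2. *)
Lemma altbinS s n : altbin s.+1 n.+1 = altbin s.+1 n + altbin s n.+1 / n.+1%:R.
Proof.
have -> : altbin s.+1 n = \sum_(1 <= k < n.+2) (-1) ^+ k.+1 * ('C(n, k))%:R / k%:R ^+ s.+1.
  by rewrite [RHS]big_nat_recr //= bin_small // mulr0 mul0r addr0.
rewrite /altbin mulr_suml -big_split /=; apply: eq_big_nat => -[//|k] _.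
have n1 := natr_neq0 (ltn0Sn n); have k1 := natr_neq0 (ltn0Sn k).
have /(congr1 (fun m => m%:R : rat)) := mul_bin_diag n.+1 k; rewrite /= !natrM => e.
have eb : ('C(n.+1, k.+1))%:R = n.+1%:R * ('C(n, k))%:R / k.+1%:R :> rat.
  by rewrite e mulrAC mulfV // mul1r.
have -> : ('C(n, k.+1))%:R = ('C(n.+1, k.+1))%:R - ('C(n, k))%:R :> rat.
  by rewrite binS natrD addrK.
rewrite eb; move: (n.+1%:R) (k.+1%:R) ((-1) ^+ k.+2) n1 k1 => N K sg n1 k1.
by rewrite exprS; field; rewrite n1 k1 expf_neq0.
Qed.

Lemma altbin1 n : altbin 1 n = hsum n.+1 1.
Proof.
elim: n => [|n IH]; first by rewrite /altbin /hsum !big_geq.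
by rewrite altbinS IH altbin0 // [RHS]hsumS // mul1r expr1.
Qed.

Lemma altbin2 n : altbin 2 n = (hsum n.+1 1 ^+ 2 + hsum n.+1 2) / 2.
Proof.
elim: n => [|n IH]; first by rewrite /altbin /hsum !big_geq // expr0n addr0 mul0r.
rewrite altbinS IH altbin1 !(@hsumS n.+1) //.
by have := natr_neq0 (ltn0Sn n); move: (n.+1%:R) => N n1; field.
Qed.

(** The square of H_s splits into twice the sum over pairs j < k, plus the diagonal. *)
Lemma hsum_double n s :
  2 * (\sum_(1 <= k < n) hsum k s / k%:R ^+ s) = hsum n s ^+ 2 - hsum n (2 * s).
Proof.
elim: n => [|[|n] IH]; first by rewrite /hsum !big_geq // mulr0 expr0n subr0.
  by rewrite /hsum !big_geq // mulr0 expr0n subr0.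
rewrite big_nat_recr // mulrDr IH !(@hsumS n.+1) // mulnC exprM.
have := natr_neq0 (ltn0Sn n); move: (n.+1%:R) => N n1.
by field; rewrite expf_neq0.
Qed.

(** * Exact expansion of A' as a signed binomial sum *)

Section Apery.
Variables (p : nat) (hp : prime p) (p7 : (7 <= p)%N).

(** This is c_k. The companion [psbin] serves as its discrete primitive: c_(k+1) is the drop of
    [psbin] from k to k+1. *)
Definition sbin (k : nat) : rat := (-1) ^+ k.+1 * ('C(p, k))%:R.
Definition psbin (k : nat) : rat := (-1) ^+ k * ('C(p.-1, k))%:R.

Lemma prime_ge7_odd : odd p.
Proof. by have [p2|//] := even_prime hp; move: p7; rewrite p2. Qed.

Lemma sbinE k : sbin k.+1 = psbin k - psbin k.+1.
Proof.
rewrite /sbin /psbin -{1}(prednK (prime_gt0 hp)) binS natrD !exprS; ring.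
Qed.

Lemma mul_sbin k : k.+1%:R * sbin k.+1 = p%:R * psbin k.
Proof.
have /(congr1 (fun m => m%:R : rat)) := mul_bin_diag p k; rewrite !natrM => e.
by rewrite /sbin /psbin mulrCA -e !exprS; ring.
Qed.

Definition sbinsum (s : nat) : rat := \sum_(1 <= k < p) sbin k / k%:R ^+ s.

(** The omitted term k = p equals p^-s, its sign being +1 because p is odd. *)
Lemma sbinsumE s : sbinsum s = altbin s p - p%:R ^- s.
Proof.
rewrite /altbin big_nat_recr ?prime_gt0 //= binn mulr1 exprS -signr_odd prime_ge7_odd expr1.
by rewrite mulrNN mulr1 mul1r addrK.
Qed.

Lemma sbinsum0 : sbinsum 0 = 0.
Proof. by rewrite sbinsumE altbin0 ?prime_gt0 // expr0 invr1 subrr. Qed.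

Lemma sbinsum1 : sbinsum 1 = hsum p 1.
Proof. by rewrite sbinsumE altbin1 hsumS ?prime_gt0 // addrK. Qed.

Lemma sbinsum2 : sbinsum 2 = (hsum p 1 ^+ 2 + hsum p 2) / 2 + hsum p 1 / p%:R.
Proof.
rewrite sbinsumE altbin2 !hsumS ?prime_gt0 //; have := natr_prime_neq0 hp.
by move: (p%:R) => P P0; field.
Qed.

Lemma psbin_sbin k : (0 < k)%N -> psbin k = (k%:R / p%:R - 1) * sbin k.
Proof.
case: k => // k _; have := natr_prime_neq0 hp => P0.
have -> : psbin k.+1 = psbin k - sbin k.+1 by rewrite sbinE; ring.
have -> : psbin k = k.+1%:R * sbin k.+1 / p%:R by rewrite mul_sbin mulrAC mulfV // mul1r.
by ring.
Qed.

(** Summation by parts: c_k is a difference of [psbin], and H_2 grows by k^-2. The boundary value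
    [psbin] at p-1 is 1, and [psbin_sbin] converts the new sum back to the c_k. *)
Lemma sum_sbin_hsum :
  \sum_(1 <= k < p) sbin k * hsum k 2 = sbinsum 1 / p%:R - sbinsum 2 - hsum p 2.
Proof.
have abel n : \sum_(1 <= k < n.+1) sbin k * hsum k 2
    = \sum_(1 <= k < n.+1) psbin k / k%:R ^+ 2 - psbin n * hsum n.+1 2.
  elim: n => [|n IH]; first by rewrite /hsum !big_geq // mulr0 subr0.
  by rewrite big_nat_recr //= IH [in RHS]big_nat_recr //= (@hsumS n.+1) // sbinE; ring.
have := abel p.-1; rewrite (prednK (prime_gt0 hp)) => ->.
have -> : psbin p.-1 = 1.
  have : ~~ odd p.-1 by have := prime_ge7_odd; rewrite -{1}(prednK (prime_gt0 hp)).
  by rewrite /psbin binn -signr_odd => /negbTE->; rewrite expr0 mulr1.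
rewrite mul1r; congr (_ - _); rewrite /sbinsum mulr_suml -sumrB.
apply: eq_big_nat => k /andP[k0 _]; rewrite psbin_sbin //.
have K0 := natr_neq0 k0; have P0 := natr_prime_neq0 hp.
by move: (k%:R) (p%:R) K0 P0 => K P K0 P0; field; rewrite K0 P0.
Qed.

Definition qprod (k : nat) : rat := \prod_(1 <= j < k) (1 - p%:R ^+ 2 / j%:R ^+ 2).

(** Up to sign, k!^2 times the left side is the product of p-j for 1 <= j <= k and p+j for 0 <= j <
    k. Pairing p-j with p+j for 0 < j < k leaves the factors p and p-k. *)
Lemma bin_mul_qprod k : (0 < k)%N ->
  (-1) ^+ k * ('C(p.-1, k))%:R * ('C(p.-1 + k, k))%:R
  = p%:R / k%:R * (1 - p%:R / k%:R) * qprod k.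
Proof.
case: k => // k _; elim: k => [|k IH].
  rewrite /qprod big_geq // expr1 !bin1 addn1 (prednK (prime_gt0 hp)) -subn1.
  by rewrite natrB ?prime_gt0 //; move: (p%:R) => P; field.
have k1 := natr_neq0 (ltn0Sn k); have k2 := natr_neq0 (ltn0Sn k.+1).
apply: (mulfI (mulf_neq0 k2 k2)).
have e1 : k.+2%:R * ('C(p.-1, k.+2))%:R = (p%:R - 1 - k.+1%:R) * ('C(p.-1, k.+1))%:R :> rat.
  (* [mul_bin_left] uses truncated subtraction, which is faithful only for k+1 <= p-1; beyond that
     both binomials are 0. *)
  have [le|lt] := leqP k.+1 p.-1; last first.
    by rewrite !bin_small ?mulr0 // ltnW.
  rewrite -natrM mul_bin_left natrM natrB // -subn1 natrB ?prime_gt0 //.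
have e2 : k.+2%:R * ('C(p.-1 + k.+2, k.+2))%:R
   = (p%:R + k.+1%:R) * ('C(p.-1 + k.+1, k.+1))%:R :> rat.
  rewrite -natrM addnS -mul_bin_diag /= natrM -natrD; congr (_%:R * _).
  by rewrite -addSn (prednK (prime_gt0 hp)).
have -> : k.+2%:R * k.+2%:R * ((-1) ^+ k.+2 * ('C(p.-1, k.+2))%:R * ('C(p.-1 + k.+2, k.+2))%:R)
  = - (p%:R - 1 - k.+1%:R) * (p%:R + k.+1%:R) *
     ((-1) ^+ k.+1 * ('C(p.-1, k.+1))%:R * ('C(p.-1 + k.+1, k.+1))%:R) :> rat.
  transitivity ((-1) ^+ k.+2 * (k.+2%:R * ('C(p.-1, k.+2))%:R)
                * (k.+2%:R * ('C(p.-1 + k.+2, k.+2))%:R) : rat).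
    by move: (k.+2%:R) => K; ring.
  by rewrite e1 e2 (exprS (-1) k.+1); move: (k.+1%:R) (_ ^+ k.+1) => K s; ring.
rewrite IH /qprod [in RHS]big_nat_recr //=.
have -> : k.+2%:R = k.+1%:R + 1 :> rat by rewrite -[k.+2]addn1 natrD.
have k3 : k.+1%:R + 1 != 0 :> rat by rewrite -natr1 in k2.
move: (k.+1%:R) (p%:R) (\prod_(_ <= _ < _) _) k1 k3 => K P Q k1 k3.
by field; rewrite k1 k3.
Qed.

(** One binomial of the square becomes [psbin], that is (k/p - 1) c_k; the other two give (p/k)(1 -
    p/k) [qprod]. The factors k/p and p/k cancel. *)
Lemma Aprime_sbin :
  (Aprime p.-1)%:R
  = 1 + \sum_(1 <= k < p) sbin k * (1 - p%:R / k%:R) ^+ 2 * qprod k :> rat.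
Proof.
rewrite /Aprime natr_sum (prednK (prime_gt0 hp)).
rewrite -(big_mkord xpredT (fun k => ('C(p.-1, k) ^ 2 * 'C(p.-1 + k, k))%:R)).
rewrite big_ltn ?prime_gt0 // !bin0 mul1n; congr (_ + _).
apply: eq_big_nat => k /andP[k0 kp].
have K0 := natr_neq0 k0; have P0 := natr_prime_neq0 hp.
have -> : ('C(p.-1, k) ^ 2 * 'C(p.-1 + k, k))%:R
   = psbin k * ((-1) ^+ k * ('C(p.-1, k))%:R * ('C(p.-1 + k, k))%:R) :> rat.
  rewrite natrM natrX /psbin.
  have s1 : (-1) ^+ k * (-1) ^+ k = 1 :> rat by rewrite -expr2 sqrr_sign.
  by rewrite -[LHS]mul1r -[X in X * _ = _]s1; ring.
rewrite bin_mul_qprod // psbin_sbin //.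
by move: (k%:R) (p%:R) K0 P0 => K P K0 P0; field; rewrite K0 P0.
Qed.

End Apery.

(** * Congruences modulo p^5 *)

Section Congruences.
Variables (p : nat) (hp : prime p) (p7 : (7 <= p)%N).

Lemma pdvd_inv k : (0 < k < p)%N -> pdvd p 0 k%:R^-1.
Proof. by move=> kP; have := pdvd_invX hp 1 kP; rewrite expr1. Qed.

Lemma pdvd_hsum0 k s : (k <= p)%N -> pdvd p 0 (hsum k s).
Proof.
move=> kp; apply: pdvd_sum => // j; rewrite mem_index_iota => /andP[j0 jk] _.
by apply: pdvd_invX => //; rewrite j0 (leq_trans jk).
Qed.

(** [psbin] at k is the product of 1 - p/j over 1 <= j <= k. *)
Lemma pdvd_psbin k : (k < p)%N -> pdvd p 1 (psbin p k - 1).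
Proof.
elim: k => [|k IH] kp.
  by rewrite /psbin expr0 bin0 mulr1 subrr; apply: pdvd0.
have -> : psbin p k.+1 - 1 = (psbin p k - 1) - p%:R * (psbin p k / k.+1%:R).
  by rewrite mulrA -mul_sbin // sbinE //; field; rewrite nat1r natr_neq0.
apply: pdvdB => //; first by apply: IH; lia.
rewrite -[p%:R]expr1; apply: (pdvd_pXM hp 1); apply: pdvdMl => //; last exact: pdvd_inv.
by rewrite -[psbin p k](subrK 1); apply: pdvdD => //; [apply/pdvdW/IH => //; lia | apply: (pdvd_nat hp 1)].
Qed.

Lemma pdvd_sbin k : (0 < k < p)%N -> pdvd p 2 (sbin p k - p%:R / k%:R).
Proof.
case: k => // k /= kp.
have k1 := natr_neq0 (ltn0Sn k).
have -> : sbin p k.+1 - p%:R / k.+1%:R = p%:R ^+ 1 * ((psbin p k - 1) / k.+1%:R).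
  by apply: (mulfI k1); rewrite mulrBr mul_sbin //; move: (k.+1%:R) k1 => K k1; field.
apply: (pdvd_pXM hp 1); apply: pdvdMr => //; last exact: pdvd_inv.
by apply: pdvd_psbin; lia.
Qed.

Lemma pdvd_sbin1 k : (0 < k < p)%N -> pdvd p 1 (sbin p k).
Proof.
move=> kP; rewrite -[sbin p k](subrK (p%:R / k%:R)); apply: pdvdD => //.
  by apply: (pdvdW hp (n := 2)) => //; apply: pdvd_sbin.
by apply: pdvdMr => //; [apply: (pdvd_pX hp 1) | apply: pdvd_inv].
Qed.

Lemma pdvd_qprod k : (k <= p)%N ->
  pdvd p 4 (qprod p k - (1 - p%:R ^+ 2 * hsum k 2)).
Proof.
elim: k => [|[|k] IH] kp.
- by rewrite /qprod /hsum !big_geq // mulr0 subr0 subrr; apply: pdvd0.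
- by rewrite /qprod /hsum !big_geq // mulr0 subr0 subrr; apply: pdvd0.
have k1 := natr_neq0 (ltn0Sn k); have kP : (0 < k.+1 < p)%N by [].
set t := _ - _ in IH.
have -> : qprod p k.+2 - (1 - p%:R ^+ 2 * hsum k.+2 2)
   = t * (1 - p%:R ^+ 2 / k.+1%:R ^+ 2) + p%:R ^+ 4 * (hsum k.+1 2 / k.+1%:R ^+ 2).
  rewrite hsumS // {1}/qprod big_nat_recr //= -/(qprod p k.+1) /t.
  by move: (k.+1%:R) k1 => K k1; field.
apply: pdvdD => //.
  apply: pdvdMr => //; first by apply: IH; lia.
  apply: pdvdB => //; first exact: (pdvd_nat hp 1).
  by apply: pdvdMl => //; [apply/pdvdX0/pdvd_nat | apply: pdvd_invX].
apply: (pdvd_pXM hp 4); apply: pdvdMl => //; last exact: pdvd_invX.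
by apply: pdvd_hsum0; lia.
Qed.

(** Fermat: k^-s and k^(p-1-s) agree modulo p. *)
Lemma pdvd_hsum s : (s < p.-1)%N -> pdvd p 1 (powsum p (p.-1 - s)) ->
  pdvd p 1 (hsum p s).
Proof.
move=> sp h.
have -> : hsum p s = powsum p (p.-1 - s)
    - \sum_(1 <= k < p) k%:R ^- s * (k%:R ^+ p.-1 - 1).
  rewrite /powsum /hsum -sumrB; apply: eq_big_nat => k kP.
  by rewrite expfB //; move: (k%:R ^- s) (k%:R ^+ p.-1) => x y; ring.
apply: pdvdB => //; apply: pdvd_sum => // k; rewrite mem_index_iota => kP _.
by apply: pdvdMl => //; [apply: pdvd_invX | apply: pdvd_fermat].
Qed.

(** Here 2^4 - 1 = 3 * 5 is prime to p because p >= 7. *)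
Lemma pow2_neq1_modp_p5 e : (p.-1 %| e + 4)%N -> 2 ^ e != 1 %[mod p].
Proof.
apply: (pow2_neq1_modp hp); first lia.
by rewrite (_ : 2 ^ 4 - 1 = 3 * 5)%N // Euclid_dvdM // !gtnNdvd //; lia.
Qed.

Lemma pdvd_powsum1 e : (0 < e)%N -> 2 ^ e != 1 %[mod p] -> pdvd p 1 (powsum p e).
Proof.
move=> e0 he; have p2 : (2 < p)%N by lia.
by have := pdvd_powsum hp 0 p2 e0 he; rewrite expn0 mul1n.
Qed.

Lemma pdvd_hsum2 : pdvd p 1 (hsum p 2).
Proof.
apply: pdvd_hsum; first lia; apply: pdvd_powsum1; first lia.
apply: (@pow2_neq1_modp _ hp _ 2); [lia | by rewrite gtnNdvd //; lia |].
by rewrite subnK //; lia.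
Qed.

Lemma pdvd_hsum4 : pdvd p 1 (hsum p 4).
Proof.
apply: pdvd_hsum; first lia; apply: pdvd_powsum1; first lia.
by apply: pow2_neq1_modp_p5; rewrite subnK //; lia.
Qed.

(** Expand 1/(p-k) = -(1/k + p/k^2 + p^2/k^3 + p^3/k^4) + p^4/(k^4 (p-k)) and sum over k; the p^3
    term is harmless since p divides H_4. *)
Lemma pdvd_hsum_refl1 :
  pdvd p 4 (2 * hsum p 1 + p%:R * hsum p 2 + p%:R ^+ 2 * hsum p 3).
Proof.
have -> : 2 * hsum p 1 + p%:R * hsum p 2 + p%:R ^+ 2 * hsum p 3
  = p%:R ^+ 4 * (\sum_(1 <= k < p) k%:R ^- 4 * (p - k)%N%:R^-1) - p%:R ^+ 3 * hsum p 4.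
  have -> : 2 * hsum p 1 = hsum p 1 + hsum p 1 by ring.
  rewrite {1}/hsum -(sum_nat_subn p (fun k => k%:R ^- 1)) /hsum !mulr_sumr -sumrB -!big_split /=.
  apply: eq_big_nat => k /andP[k0 kp].
  have K0 := natr_neq0 k0.
  have : (p - k)%N%:R != 0 :> rat by apply: natr_neq0; rewrite subn_gt0.
  rewrite natrB ?(ltnW kp) //; move: (k%:R) (p%:R) K0 => K P K0 KP.
  by field; rewrite K0 KP.
apply: pdvdB => //; last exact: (pdvd_pXM hp 3 pdvd_hsum4).
apply: (pdvd_pXM hp 4); apply: pdvd_sum => // k; rewrite mem_index_iota => /andP[k0 kp] _.
by apply: pdvdMl => //; [apply: pdvd_invX; rewrite ?k0 | apply: pdvd_inv; lia].
Qed.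

(** Same reflection: (p-k)^-3 + k^-3 is -3p/k^4 plus p^2 times the displayed p-integral remainder,
    and p divides H_4. *)
Lemma pdvd_hsum3 : pdvd p 2 (hsum p 3).
Proof.
apply: (@pdvd_unit _ hp 2); first by rewrite gtnNdvd //; lia.
have -> : 2 * hsum p 3 =
  p%:R ^+ 2 * (\sum_(1 <= k < p) k%:R ^- 4 * (p - k)%N%:R ^- 3
     * (6 * k%:R ^+ 2 - 8 * p%:R * k%:R + 3 * p%:R ^+ 2)) - 3 * (p%:R ^+ 1 * hsum p 4).
  have -> : 2 * hsum p 3 = hsum p 3 + hsum p 3 by ring.
  rewrite {1}/hsum -(sum_nat_subn p (fun k => k%:R ^- 3)) /hsum !mulr_sumr -sumrB -!big_split /=.
  apply: eq_big_nat => k /andP[k0 kp].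
  have K0 := natr_neq0 k0.
  have : (p - k)%N%:R != 0 :> rat by apply: natr_neq0; rewrite subn_gt0.
  rewrite natrB ?(ltnW kp) //; move: (k%:R) (p%:R) K0 => K P K0 KP.
  by field; rewrite K0 KP.
have hn k : pdvd p 0 k%:R := pdvd_nat hp k.
apply: pdvdB => //; last by apply: pdvdMl => //; apply: (pdvd_pXM hp 1 pdvd_hsum4).
apply: (pdvd_pXM hp 2); apply: pdvd_sum => // k; rewrite mem_index_iota => /andP[k0 kp] _.
apply: pdvdMl => //.
  by apply: pdvdMl => //; apply: pdvd_invX => //; [rewrite k0 | lia].
apply: pdvdD => //; last by apply: pdvdMl => //; apply: pdvdX0.
by apply: pdvdB => //; apply: pdvdMl => //; [apply: pdvdX0 | apply: pdvdMl].
Qed.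

Lemma pdvd_hsum1 : pdvd p 2 (hsum p 1).
Proof.
apply: (@pdvd_unit _ hp 2); first by rewrite gtnNdvd //; lia.
have -> : 2%:R * hsum p 1 = (2 * hsum p 1 + p%:R * hsum p 2 + p%:R ^+ 2 * hsum p 3)
   - p%:R ^+ 1 * hsum p 2 - p%:R ^+ 2 * hsum p 3 by ring.
apply: pdvdB => //; first apply: pdvdB => //.
- by apply: pdvdW pdvd_hsum_refl1.
- exact: (pdvd_pXM hp 1 pdvd_hsum2).
- by apply: (pdvdW hp _ (pdvd_pXM hp 2 pdvd_hsum3)).
Qed.

Lemma Aprime_hsum :
  pdvd p 5 ((Aprime p.-1)%:R - 1 + p%:R * hsum p 1 - 2 * p%:R ^+ 2 * hsum p 2).
Proof.
(* Three error terms: f truncates the product, g is the p^4 part of (1 - p/k)^2 p^2 H_2, and h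
   replaces c_k by p/k in the cross term 2 p^3 c_k H_2 / k (H_2 summed below k). *)
pose f k : rat := sbin p k * (1 - p%:R / k%:R) ^+ 2
                   * (qprod p k - (1 - p%:R ^+ 2 * hsum k 2)).
pose g k : rat := sbin p k * hsum k 2 / k%:R ^+ 2.
pose h k : rat := (sbin p k - p%:R / k%:R) * hsum k 2 / k%:R.
have -> : (Aprime p.-1)%:R - 1 + p%:R * hsum p 1 - 2 * p%:R ^+ 2 * hsum p 2
  = \sum_(1 <= k < p) f k - p%:R ^+ 4 * (\sum_(1 <= k < p) g k)
    + 2 * (p%:R ^+ 3 * (\sum_(1 <= k < p) h k))
    + p%:R ^+ 4 * (hsum p 2 ^+ 2 - hsum p 4) + p%:R ^+ 2 * hsum p 1 ^+ 2.
  rewrite -(hsum_double p 2) Aprime_sbin //.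
  have -> : \sum_(1 <= k < p) sbin p k * (1 - p%:R / k%:R) ^+ 2 * qprod p k
    = \sum_(1 <= k < p) f k - p%:R ^+ 4 * (\sum_(1 <= k < p) g k)
      + 2 * (p%:R ^+ 3 * (\sum_(1 <= k < p) h k))
      + p%:R ^+ 4 * (2 * (\sum_(1 <= k < p) hsum k 2 / k%:R ^+ 2))
      + sbinsum p 0 - 2 * (p%:R * sbinsum p 1) + p%:R ^+ 2 * sbinsum p 2
      - p%:R ^+ 2 * (\sum_(1 <= k < p) sbin p k * hsum k 2).
    rewrite /sbinsum !mulr_sumr -!sumrN -!big_split /=.
    apply: eq_big_nat => k /andP[k0 _]; rewrite /f /g /h.
    have := natr_neq0 k0; move: (hsum k 2) (sbin p k) (k%:R) (p%:R) => X s K P K0.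
    by field.
  rewrite sum_sbin_hsum // sbinsum0 // sbinsum1 // sbinsum2 //.
  have := natr_prime_neq0 hp; move: (\sum_(_ <= _ < _) f _) (\sum_(_ <= _ < _) g _) (\sum_(_ <= _ < _) h _) => F G H.
  by move: (p%:R) (\sum_(_ <= _ < _) _) => P X P0; field.
have kP k : k \in index_iota 1 p -> (0 < k < p)%N by rewrite mem_index_iota.
have hi k s : k \in index_iota 1 p -> pdvd p 0 (hsum k s).
  by move=> /kP/andP[_ /ltnW kp]; apply: pdvd_hsum0.
apply: pdvdD => //; first apply: pdvdD => //; first apply: pdvdD => //; first apply: pdvdB => //.
- apply: pdvd_sum => // k kin _; rewrite /f; apply: (pdvdM hp (m := 1)).
    apply: pdvdMr => //; first exact/pdvd_sbin1/kP.
    apply/pdvdX0 => //; apply: pdvdB => //; first exact: (pdvd_nat hp 1).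
    by apply: pdvdMl => //; [apply: pdvd_nat | apply/pdvd_inv/kP].
  by apply: pdvd_qprod; have := kP k kin; lia.
- apply: (pdvd_pXM hp 4); apply: pdvd_sum => // k kin _.
  apply: pdvdMr => //; last by apply: pdvd_invX => //; apply: kP.
  by apply: pdvdMr => //; [apply/pdvd_sbin1/kP | apply: hi].
- apply: pdvdMl => //; first exact: (pdvd_nat hp 2).
  apply: (pdvd_pXM hp 3); apply: pdvd_sum => // k kin _.
  apply: pdvdMr => //; last exact/pdvd_inv/kP.
  by apply: pdvdMr => //; [apply/pdvd_sbin/kP | apply: hi].
- apply: (pdvd_pXM hp 4); apply: pdvdB => //; last exact: pdvd_hsum4.
  by apply: (pdvdW hp _ (pdvdX hp 2 pdvd_hsum2)).
by apply: (pdvdW hp _ (pdvd_pXM hp 2 (pdvdX hp 2 pdvd_hsum1))).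
Qed.

(** As m-2 is -4 modulo p-1, p divides S_(m-2); m-1 is odd, so reflection gives p^2 dividing
    S_(m-1). This covers m = p-3 and m = 2p-4. *)
Lemma powsum_bernoulli_mul4 m : (2 < m)%N -> ~~ odd m -> (p.-1 %| m.-2 + 4)%N ->
  pdvd p 3 (powsum p m - p%:R * bernoulli m).
Proof.
move=> m2 em hm; have h1 : pdvd p 1 (powsum p m.-2).
  by apply: pdvd_powsum1; [lia | apply: pow2_neq1_modp_p5].
apply: powsum_bernoulli_modp3 => //.
have -> : m.-1 = m.-2.+1 by lia.
apply: pdvd2_powsum_odd => //; lia.
Qed.

Lemma Aprime_bernoulli :
  pdvd p 5 ((Aprime p.-1)%:R - (1 +
    (p ^ 3)%N%:R * (10 / 3 * bernoulli (p - 3) - 5 / 4 * bernoulli (2 * p - 4))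
       + 5 / 18 * (p ^ 4)%N%:R * bernoulli (p - 3))).
Proof.
have p_odd := prime_ge7_odd hp p7.
have hB1 : pdvd p 3 (powsum p (p - 3) - p%:R * bernoulli (p - 3)).
  apply: powsum_bernoulli_mul4; [lia | lia | apply/dvdnP; exists 1%N; lia].
have hB2 : pdvd p 3 (powsum p (2 * p - 4) - p%:R * bernoulli (2 * p - 4)).
  apply: powsum_bernoulli_mul4; [lia | lia | apply/dvdnP; exists 2%N; lia].
have hH := hsum2_powsum hp p7.
have hA := Aprime_hsum; have hR := pdvd_hsum_refl1; have hH3 := pdvd_hsum3.
have p36 : ~~ (p %| 36)%N.
  by rewrite (_ : 36 = 2 ^ 2 * 3 ^ 2)%N // Euclid_dvdM // !Euclid_dvdX // !gtnNdvd //; lia.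
apply: (pdvd_unit hp p36); rewrite !natrX.
move: hB1 hB2 hH; set B1 := bernoulli _; set B2 := bernoulli _.
set S1 := powsum _ _; set S2 := powsum _ _.
move: (Aprime _)%:R (hsum p 1) (hsum p 2) (hsum p 3) hA hR hH3 => A H1 H2 H3 hA hR hH3.
set t1 := S1 - _ => hB1; set t2 := S2 - _ => hB2; set t3 := H2 - _ => hH.
set t4 := _ - _ in hA; set t5 := _ + _ in hR.
(* The reflection, scaled by p/2, replaces -p H_1 by p^2 H_2 / 2 up to p^3 H_3 / 2. The weights of
   t3, t1, t2 and the last t1 are 36 times 5/2, 10/3, 5/4 and 5/18. *)
have -> : 36%:R * (A - (1 + p%:R ^+ 3 * (10 / 3 * B1 - 5 / 4 * B2) + 5 / 18 * p%:R ^+ 4 * B1))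
  = 36%:R * t4 - 18%:R * (p%:R ^+ 1 * t5) + 18%:R * (p%:R ^+ 3 * H3)
    + 90%:R * (p%:R ^+ 2 * t3) + 120%:R * (p%:R ^+ 2 * t1) - 45%:R * (p%:R ^+ 2 * t2)
    + 10%:R * (p%:R ^+ 3 * t1).
  by rewrite /t1 /t2 /t3 /t4 /t5; move: (p%:R) (S1) (S2) (B1) (B2) => P s1 s2 b1 b2; field.
have hn k m x : pdvd p m x -> pdvd p m (k%:R * x).
  by move=> hx; apply: pdvdMl => //; apply: pdvd_nat.
have hpX i m x : pdvd p m x -> pdvd p (i + m) (p%:R ^+ i * x) := @pdvd_pXM p hp i m x.
apply: pdvdD => //; last by apply/hn/(pdvdW hp _ (hpX 3 3 _ hB1)).
apply: pdvdB => //; last by apply/hn/(hpX 2 3).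
do 2!(apply: pdvdD => //; last by apply/hn/(hpX 2 3)).
apply: pdvdD => //; last by apply/hn/(hpX 3 2).
by apply: pdvdB => //; apply/hn => //; apply: (hpX 1 4).
Qed.

End Congruences.

Theorem theorem1p2 (p : nat) (hp : prime p) (hp7 : (7 <= p)%N) :
  congr_mod_ppow p 5 (Aprime p.-1)%:R
    (1 + (p ^ 3)%N%:R * (10 / 3 * bernoulli (p - 3) - 5 / 4 * bernoulli (2 * p - 4))
       + 5 / 18 * (p ^ 4)%N%:R * bernoulli (p - 3)).
Proof.
have [a [d [dP e]]] := Aprime_bernoulli hp hp7.
exists (a%:~R / d%:R); split; last by rewrite e natrX.
by apply: pdvd0_p_integral => //; exists a, d; rewrite mul1r.
Qed.
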